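(* Let $p>1$ and $0<u<p$ be real and $d$ a positive integer. Define a random sequence $d=\lambda_0'\ge\lambda_1'\ge\lambda_2'\ge\cdots$ of nonnegative integers by the Markov rule: if $\lambda_i'=a$, then $\lambda_{i+1}'=b$ (for $0\le b\le a$) with probability \[ K(a,b)=\frac{u^b\,(1/p)_a\,(u/p)_a}{p^{b^2}\,(1/p)_{a-b}\,(1/p)_b\,(u/p)_b}. \] Then the partition $\lambda$ whose column lengths are $\lambda_1',\lambda_2',\ldots$ is distributed according to $P_{d,u}$.
   Context: Write $(x)_i=(1-x)(1-x/p)\cdots(1-x/p^{i-1})$ (with $(x)_0=1$). For a partition $\lambda$: $|\lambda|=\sum\lambda_i$, $m_i(\lambda)$ is the number of parts equal to $i$, $\lambda_i'$ is the length of the $i$-th column of its diagram, and $r=\lambda_1'$ is its number of parts. The measure $P_{d,u}$ on partitions is defined by $P_{d,u}(\lambda)=\frac{u^{|\lambda|}}{p^{\sum_i(\lambda_i')^2}\prod_i (1/p)_{m_i(\lambda)}}\prod_{i=1}^d(1-u/p^i)\prod_{i=d-r+1}^d(1-1/p^i)$ if $r\le d$, and $0$ otherwise. *)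

(* Defs.v *)
From HB Require Import structures.
From mathcomp Require Import all_boot all_order all_algebra.
From mathcomp Require Import all_classical all_reals all_analysis.
Set Implicit Arguments.
Unset Strict Implicit.
Unset Printing Implicit Defensive.
Import Order.TTheory GRing.Theory Num.Theory.
Local Open Scope classical_set_scope.
Local Open Scope ring_scope.

(* Integer partitions, as weakly decreasing sequences of positive parts. *)
Record intpart := IntPart {
  parts :> seq nat ;
  _ : sorted geq parts && (0%N \notin parts) }.

HB.instance Definition _ := [isSub for parts].
HB.instance Definition _ := [Countable of intpart by <:].

(* The i-th column length of the diagram (i >= 1), the number of parts >= i;
   the value at i = 0 is meaningless and never used. *)
Definition col (la : intpart) (i : nat) : nat := count (leq i) la.

Definition largest (la : intpart) : nat := head 0%N la.

Section Weights.
Variables (R : realType) (p u : R).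

(* (x)_i = (1 - x)(1 - x/p)...(1 - x/p^(i-1)) *)
Definition poch (x : R) (i : nat) : R := \prod_(j < i) (1 - x / p ^+ j).

(* The products and sums over all i >= 1 in the weight are cut off at the
   largest part, beyond which col la i = 0 and m_i(la) = 0. *)
Definition Pdu (d : nat) (la : intpart) : R :=
  if (size la <= d)%N then
    u ^+ sumn la /
      (p ^+ (\sum_(1 <= i < (largest la).+1) col la i ^ 2)%N *
       \prod_(1 <= i < (largest la).+1) poch p^-1 (count_mem i la))
    * \prod_(1 <= i < d.+1) (1 - u / p ^+ i)
    * \prod_(d - size la + 1 <= i < d.+1) (1 - 1 / p ^+ i)
  else 0.

Definition K (a b : nat) : R :=
  if (b <= a)%N then
    (u ^+ b * poch p^-1 a * poch (u / p) a) /
    (p ^+ (b ^ 2)%N * poch p^-1 (a - b) * poch p^-1 b * poch (u / p) b)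
  else 0.

End Weights.

Section Chain.
Context {disp : measure_display} {T : measurableType disp} {R : realType}.
Variable P : probability T R.

Definition cylinder (X : nat -> T -> nat) (n : nat) (a : nat -> nat) : set T :=
  [set t | forall i, (i <= n)%N -> X i t = a i].

(* X is a Markov chain on nat started at x0 with transition matrix k. The
   second clause is
   P(X_(n+1) = a_(n+1) | X_0 = a_0, ..., X_n = a_n) = k a_n a_(n+1),
   multiplied out so that conditioning events may have probability 0. *)
Definition markov_chain (x0 : nat) (k : nat -> nat -> R)
    (X : nat -> {RV P >-> nat}) : Prop :=
  P [set t | X 0%N t = x0] = 1%E /\
  forall (n : nat) (a : nat -> nat),
    P (cylinder X n.+1 a) = (P (cylinder X n a) * (k (a n) (a n.+1))%:E)%E.

End Chain.

Definition has_columns (la : intpart) (c : nat -> nat) : Prop :=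
  forall i, (1 <= i)%N -> col la i = c i.

(* Main.v *)
(* The numbers [K a b] sum to 1 over [b] by a limit case of the
   q-Chu-Vandermonde identity, proved by induction on [a] for all [u] at once.
   The probability of a path is the product of its transition probabilities;
   along the columns of a partition, which vanish eventually, this product
   stabilizes (since [K 0 0 = 1]) and telescopes to [Pdu]. Finally, an upward
   step has probability 0, so almost every trajectory is nonincreasing, hence
   eventually constant; there are countably many eventually constant sequences,
   and those with a positive limit [v] have probability 0 because [K v v < 1].
   The surviving trajectories are the column sequences of partitions. *)
Require Import Defs.
From HB Require Import structures.
From mathcomp Require Import all_boot all_order all_algebra.
From mathcomp Require Import all_classical all_reals all_analysis.
From mathcomp Require Import ring zify.
Import Order.TTheory GRing.Theory Num.Theory.
Import numFieldNormedType.Exports.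
Local Open Scope classical_set_scope.
Local Open Scope ring_scope.

(** * Pochhammer products and Gaussian binomials *)

Section Algebra.
Set Implicit Arguments.
Unset Strict Implicit.
Unset Printing Implicit Defensive.

Variables (R : realType) (p : R).
Hypothesis hp : 1 < p.

Let p0 : 0 < p. Proof. exact: lt_trans hp. Qed.
Let pn0 n : p ^+ n != 0. Proof. by rewrite expf_neq0 // gt_eqF. Qed.

Lemma poch0 x : poch p x 0 = 1. Proof. exact: big_ord0. Qed.

Lemma pochS x n : poch p x n.+1 = poch p x n * (1 - x / p ^+ n).
Proof. exact: big_ord_recr. Qed.

Lemma poch_recl x n : poch p x n.+1 = (1 - x) * poch p (x / p) n.
Proof.
rewrite /poch big_ord_recl expr0 divr1; congr (_ * _).
by apply: eq_bigr => i _; rewrite exprS invfM mulrA.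
Qed.

Lemma poch_gt0 x n : 0 < x < 1 -> 0 < poch p x n.
Proof.
move=> /andP[x0 x1]; apply: prodr_gt0 => i _.
rewrite subr_gt0 ltr_pdivrMr ?exprn_gt0// mul1r (lt_le_trans x1)//.
by rewrite exprn_ege1// ltW.
Qed.

Lemma invp_itv : 0 < p^-1 < 1.
Proof. by rewrite invr_gt0 p0 invf_lt1. Qed.

Lemma divp_itv (u : R) : 0 < u < p -> 0 < u / p < 1.
Proof. by move=> /andP[u0 up]; rewrite divr_gt0//= ltr_pdivrMr// mul1r. Qed.

Lemma divpp_itv (u : R) : 0 < u < p -> 0 < u / p < p.
Proof. by move=> /divp_itv/andP[-> /lt_trans]; apply. Qed.

(* The Gaussian binomial coefficient at [q = 1/p]. *)
Fixpoint qbin (a b : nat) : R :=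
  match a, b with
  | _, 0%N => 1
  | 0%N, _.+1 => 0
  | a'.+1, b'.+1 => qbin a' b'.+1 + p ^- (a' - b') * qbin a' b'
  end.

Lemma qbin0r a : qbin a 0 = 1. Proof. by case: a. Qed.

Lemma qbinS a b :
  qbin a.+1 b.+1 = qbin a b.+1 + p ^- (a - b) * qbin a b.
Proof. by []. Qed.

Lemma qbin_small a b : (a < b)%N -> qbin a b = 0.
Proof.
elim: a b => [|a IH] [|b]//= ab.
by rewrite !IH ?mulr0 ?addr0// ltnW.
Qed.

(** Product formula for the Gaussian binomial, with denominators cleared. Pascal's rule at
    [(b + 1, c + 1)] calls on [(b + 1, c)] and [(b, c + 1)], hence the induction on [b + c]. *)
Lemma qbin_poch b c : qbin (b + c) b * poch p p^-1 b * poch p p^-1 c =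
  poch p p^-1 (b + c).
Proof.
have [n] := ubnP (b + c); elim: n b c => // n IH [|b] c bc.
  by rewrite qbin0r poch0 !mul1r.
case: c bc => [|c] bc.
  rewrite poch0 mulr1 !addn0 /= qbin_small// add0r subnn expr0 invr1 mul1r.
  by have := IH b 0%N; rewrite poch0 mulr1 addn0 pochS mulrA => -> //; lia.
have E1 : qbin (b.+1 + c) b.+1 * poch p p^-1 b.+1 * poch p p^-1 c =
    poch p p^-1 (b.+1 + c) by apply: IH; lia.
have E2 : qbin (b + c.+1) b * poch p p^-1 b * poch p p^-1 c.+1 =
    poch p p^-1 (b + c.+1) by apply: IH; lia.
have -> : (b.+1 + c.+1 = (b.+1 + c).+1)%N by lia.
rewrite -addSnnS in E2; rewrite qbinS (_ : b.+1 + c - b = c.+1)%N; last by lia.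
rewrite mulrDl mulrDl.
have -> : qbin (b.+1 + c) b.+1 * poch p p^-1 b.+1 * poch p p^-1 c.+1 =
    (1 - p^-1 / p ^+ c) * poch p p^-1 (b.+1 + c).
  by rewrite -E1 [poch _ _ c.+1]pochS; ring.
have -> : p ^- c.+1 * qbin (b.+1 + c) b * poch p p^-1 b.+1 * poch p p^-1 c.+1 =
    p ^- c.+1 * (1 - p^-1 / p ^+ b) * poch p p^-1 (b.+1 + c).
  by rewrite -E2 [poch _ _ b.+1]pochS; ring.
(* With the common factor removed, what remains is [(1 - p^-(c+1)) + p^-(c+1) (1 - p^-(b+1)) = 1 -
   p^-(b+c+2)]. *)
rewrite [in RHS]pochS -mulrDl mulrC; congr (_ * _).
rewrite exprS addSn exprS exprD.
by field; rewrite !pn0 gt_eqF.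
Qed.

(* A limit case of the q-Chu-Vandermonde summation. Pascal's rule splits the
   sum for [a + 1] into the sum for [a] and the sum for [a] at [u / p]. *)
Lemma sum_qbin a (u : R) : 0 < u < p ->
  \sum_(b < a.+1) qbin a b * (u ^+ b / p ^+ (b ^ 2)%N / poch p (u / p) b) =
  (poch p (u / p) a)^-1.
Proof.
elim: a u => [|a IH] u hu.
  by rewrite big_ord_recl big_ord0 /= poch0 expr0 !divr1 addr0 invr1 mulr1.
have hu1 := divp_itv hu; have hu2 := divpp_itv hu.
rewrite big_ord_recl qbin0r.
under eq_bigr do rewrite /= /bump /= add1n mulrDl.
rewrite big_split /= addrA.
(* The term [b = 0] and the first half of Pascal's rule recombine into the sum for [a]; the extra
   top term has [qbin a a.+1 = 0]. *)
set S1 := (X in X + _ = _).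
have -> : S1 = (poch p (u / p) a)^-1.
  rewrite -(IH u hu) /S1 [in RHS]big_ord_recl qbin0r.
  by rewrite big_ord_recr /= qbin_small// mul0r addr0.
(* In the second half the exponent of [1/p] is [(a - b) + (b + 1)^2 = (a + 1) + b + b^2]; the [b]
   turns [u ^+ b] into [(u / p) ^+ b], so the induction hypothesis applies at [u / p]. *)
rewrite (eq_bigr (fun b : 'I_a.+1 => u / p ^+ a.+1 / (1 - u / p) * (qbin a b *
   ((u / p) ^+ b / p ^+ (b ^ 2)%N / poch p (u / p / p) b)))); last first.
  move=> b _; rewrite poch_recl.
  have -> : (b.+1 ^ 2 = b ^ 2 + b + b.+1)%N by lia.
  have E : p ^+ a = p ^+ (a - b) * p ^+ b.
    by rewrite -exprD; congr (_ ^+ _); have := ltn_ord b; lia.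
  rewrite [p ^+ a.+1]exprS E !exprD exprMn !exprS.
  have := poch_gt0 b (divp_itv hu2).
  rewrite exprVn => h1; have h2 : 0 < p - u by rewrite subr_gt0; case/andP: hu.
  by field; rewrite !pn0 !gt_eqF.
rewrite -mulr_sumr IH//.
have h1 := poch_gt0 a (divp_itv hu2); have h2 := poch_gt0 a hu1.
have h3 : 0 < 1 - u / p by rewrite subr_gt0; case/andP: hu1.
have h4 : 0 < 1 - u / p / p ^+ a.
  by move: (poch_gt0 a.+1 hu1); rewrite pochS pmulr_rgt0.
(* Multiplied by [(u/p)_(a+1)], the two halves become [1 - u / p^(a+1)] and [u / p^(a+1)]. *)
apply: (mulIf (lt0r_neq0 (poch_gt0 a.+1 hu1))).
rewrite mulVf ?lt0r_neq0 ?poch_gt0// mulrDl {1}pochS mulrA mulVf ?lt0r_neq0// mul1r.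
rewrite poch_recl [_ / _ * _ * _](_ : _ = u / p ^+ a.+1).
  by rewrite exprS invfM; ring.
have h5 : 0 < p - u by rewrite subr_gt0; case/andP: hu.
by field; rewrite pn0 !lt0r_neq0.
Qed.

(** * The transition kernel *)

Section Kernel.
Variables (u : R).
Hypothesis hu : 0 < u < p.

Lemma K_ge0 a b : 0 <= K p u a b.
Proof.
rewrite /K; case: ifP => // _; case/andP: (hu) => u0 _.
by rewrite divr_ge0 ?mulr_ge0 ?exprn_ge0 ?(ltW p0) ?(ltW u0)// ltW// poch_gt0
  ?invp_itv ?divp_itv.
Qed.

(** By [qbin_poch], [K p u a b] is [(u/p)_a] times the [b]-th summand of [sum_qbin]. *)
Lemma K_sum a : \sum_(b < a.+1) K p u a b = 1.
Proof.
rewrite -(divff (lt0r_neq0 (poch_gt0 a (divp_itv hu)))) -sum_qbin// mulr_sumr.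
apply: eq_bigr => b _; have ba : (b <= a)%N by rewrite -ltnS.
rewrite /K ba; have := qbin_poch b (a - b); rewrite subnKC// => <-.
have := poch_gt0 b invp_itv; have := poch_gt0 (a - b) invp_itv.
have := poch_gt0 b (divp_itv hu) => h1 h2 h3.
by field; rewrite !pn0 !gt_eqF.
Qed.

Lemma K_r0 a : K p u a 0 = poch p (u / p) a.
Proof.
rewrite /K /= subn0 !poch0 !expr0 !mulr1 !mul1r mulrAC divff ?mul1r//.
by rewrite gt_eqF ?poch_gt0 ?invp_itv.
Qed.

Lemma K00 : K p u 0 0 = 1. Proof. by rewrite K_r0 poch0. Qed.

(** The row sum 1 also contains the separate term [K p u a 0 = (u/p)_a > 0]. *)
Lemma K_diag_lt1 a : (0 < a)%N -> K p u a a < 1.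
Proof.
move=> a0; rewrite -(K_sum a) big_ord_recr /= ltrDr.
case: a a0 => // a _; rewrite big_ord_recl ltr_pwDl//.
  by rewrite K_r0 poch_gt0 ?divp_itv.
by apply: sumr_ge0 => i _; exact: K_ge0.
Qed.

End Kernel.
End Algebra.

(* [col] alone would denote a matrix column here. *)
Local Notation col := Defs.col.

(** * Partitions and their columns *)

Section Partitions.
Set Implicit Arguments.
Unset Strict Implicit.
Unset Printing Implicit Defensive.

Lemma part_gt0 (la : intpart) x : x \in (la : seq nat) -> (0 < x)%N.
Proof. by case: la => s /= /andP[_ s0] xs; case: x xs s0 => // ->. Qed.

Lemma part_le_largest (la : intpart) x : x \in (la : seq nat) -> (x <= largest la)%N.
Proof.
case: la => -[|y s] // laP; have /andP[ss _] := laP.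
rewrite inE /largest /= => /orP[/eqP->//|].
by move: ss => /=; rewrite path_sortedE;
  [move=> /andP[/allP h _] /h|exact/rev_trans/leq_trans].
Qed.

Lemma col1 (la : intpart) : col la 1 = size la.
Proof. by apply/eqP; rewrite -all_count; apply/allP => x /part_gt0. Qed.

Lemma col_gt_largest (la : intpart) i : (largest la < i)%N -> col la i = 0%N.
Proof.
move=> li; apply/eqP; rewrite -leqn0 leqNgt -has_count; apply/hasPn => x /part_le_largest xl.
by rewrite -ltnNge (leq_ltn_trans xl).
Qed.

Lemma count_mem_col (la : intpart) i :
  (count_mem i la + col la i.+1 = col la i)%N.
Proof.
rewrite /col; elim: (la : seq nat) => //= x s <-.
by case: (ltngtP i x) => //=; lia.
Qed.

Lemma leq_col (la : intpart) i : (col la i.+1 <= col la i)%N.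
Proof. by rewrite -(count_mem_col la i) leq_addl. Qed.

(** Double counting of the boxes of the diagram, by rows and by columns. *)
Lemma sumn_col (la : intpart) :
  sumn la = (\sum_(i < largest la) col la i.+1)%N.
Proof.
under eq_bigr do rewrite /col -sum1_count big_mkcond.
rewrite exchange_big /= sumnE; apply: eq_big_seq => x /part_le_largest xl.
rewrite -big_mkcond /= -{1}(card_ord x) -sum1_card.
by rewrite (big_ord_widen _ (fun=> 1%N) xl).
Qed.

(* The partition is the conjugate of the column sequence: its [j]-th part is
   the number of columns longer than [j]. *)
Lemma exists_columns (c : nat -> nat) N :
  (forall i, (c i.+2 <= c i.+1)%N) -> c N.+1 = 0%N ->
  exists la : intpart, has_columns la c.
Proof.
move=> c_dec cN.
have mono i k : (i <= k)%N -> (c k.+1 <= c i.+1)%N.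
  elim: k => [|k IH]; first by rewrite leqn0 => /eqP->.
  by rewrite leq_eqVlt => /orP[/eqP->//|/IH]; exact: leq_trans.
have ex j : exists k, (c k.+1 <= j)%N by exists N; rewrite cN.
pose f j := ex_minn (ex j).
(* Both sides say that the box in row [j] and column [k], counted from 0, lies in the diagram. *)
have fP j k : (k < f j)%N = (j < c k.+1)%N.
  rewrite /f; case: ex_minnP => m cm mmin; apply/idP/idP => h.
    by rewrite ltnNge; apply/negP => /mmin; rewrite leqNgt h.
  by rewrite ltnNge; apply/negP => /mono cmk; move: (leq_trans cmk cm); rewrite leqNgt h.
pose s := [seq f j | j <- iota 0 (c 1%N)].
have sP : sorted geq s && (0%N \notin s).
  apply/andP; split.
    rewrite sorted_map; apply: (sub_sorted (e := leq)); last exact: iota_sorted.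
    move=> i j /= ij; rewrite leqNgt fP -leqNgt.
    by rewrite (leq_trans _ ij)// leqNgt -fP ltnn.
  apply/mapP => -[j]; rewrite mem_iota add0n /= => jc /esym fj.
  by move: jc; rewrite -fP fj.
exists (IntPart sP) => -[//|i] _; rewrite /col /= count_map.
rewrite (eq_count (a2 := fun j => (j < c i.+1)%N)); last by move=> j /=; rewrite fP.
rewrite -(subnKC (mono 0%N i isT)) iotaD count_cat add0n.
rewrite (eq_in_count (a2 := xpredT)); last first.
  by move=> j; rewrite mem_iota add0n => /andP[_ ->].
rewrite count_predT size_iota [X in (_ + X)%N](_ : _ = 0%N) ?addn0//.
rewrite (eq_in_count (a2 := pred0)) ?count_pred0// => j.
by rewrite mem_iota => /andP[h _]; rewrite ltnNge h.
Qed.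

End Partitions.

(** * Products of transition probabilities along a path *)

Definition path_weight {R : realType} (k : nat -> nat -> R) (a : nat -> nat) n : R :=
  \prod_(i < n) k (a i) (a i.+1).

Section PathWeight.
Set Implicit Arguments.
Unset Strict Implicit.
Unset Printing Implicit Defensive.

Variables (R : realType) (p u : R).
Hypotheses (hp : 1 < p) (hu : 0 < u < p).

(** The factors [(1/p)_b (u/p)_b] in the denominator of a step into [b] cancel those in the
    numerator of the next step, so only the two endpoints survive. *)
Lemma path_weightE (a : nat -> nat) n : (forall i, (a i.+1 <= a i)%N) ->
  path_weight (K p u) a n =
  u ^+ (\sum_(i < n) a i.+1)%N * poch p p^-1 (a 0%N) * poch p (u / p) (a 0%N) /
  (p ^+ (\sum_(i < n) a i.+1 ^ 2)%N * \prod_(i < n) poch p p^-1 (a i - a i.+1) *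
   poch p p^-1 (a n) * poch p (u / p) (a n)).
Proof.
have q0 k : 0 < poch p p^-1 k by apply/poch_gt0/invp_itv.
have u0 k : 0 < poch p (u / p) k by apply/poch_gt0/divp_itv.
have p0 k : 0 < p ^+ k by rewrite exprn_gt0 ?(lt_trans _ hp).
move=> a_dec; rewrite /path_weight; elim: n => [|n IH].
  by rewrite !big_ord0 !expr0 !mul1r divff// gt_eqF ?mulr_gt0.
rewrite !big_ord_recr /= IH /K a_dec !exprD.
have : 0 < \prod_(i < n) poch p p^-1 (a i - a i.+1) by apply: prodr_gt0 => i _.
by move=> h; field; rewrite !gt_eqF.
Qed.

Lemma poch_nat x n : poch p (x / p) n = \prod_(1 <= i < n.+1) (1 - x / p ^+ i).
Proof.
rewrite big_add1 big_mkord; apply: eq_bigr => i _.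
by rewrite exprS invfM mulrA.
Qed.

(** Index 0 carries the starting state [d] of the chain, whereas [col la 0] would be the number of
    parts. *)
Definition columns_from d (la : intpart) i := if i is 0%N then d else col la i.

(** The path has one step more than there are columns, so it ends at 0, where the remaining
    Pochhammer products are 1. If [la] has more than [d] parts, the first step goes up and both
    sides vanish. *)
Lemma path_weight_columns d (la : intpart) :
  path_weight (K p u) (columns_from d la) (largest la).+1 = Pdu p u d la.
Proof.
rewrite /Pdu; case: leqP => [ld|dl]; last first.
  by rewrite /path_weight big_ord_recl /= /K col1 leqNgt dl /= mul0r.
rewrite path_weightE; last by case=> [|i]; rewrite /= ?col1// leq_col.
have c0 : col la (largest la).+1 = 0%N by rewrite col_gt_largest.
have -> : (\sum_(i < (largest la).+1) columns_from d la i.+1 = sumn la)%N.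
  by rewrite big_ord_recr /= c0 addn0 sumn_col.
have -> : (\sum_(i < (largest la).+1) columns_from d la i.+1 ^ 2 =
    \sum_(1 <= i < (largest la).+1) col la i ^ 2)%N.
  by rewrite big_ord_recr /= c0 addn0 big_add1 big_mkord.
have -> : \prod_(i < (largest la).+1)
      poch p p^-1 (columns_from d la i - columns_from d la i.+1) =
    poch p p^-1 (d - size la) *
    \prod_(1 <= i < (largest la).+1) poch p p^-1 (count_mem i la).
  rewrite big_ord_recl /= col1 big_add1 big_mkord; congr (_ * _).
  by apply: eq_bigr => i _; rewrite /bump /= add1n -(count_mem_col la i.+1) addnK.
have E n : poch p p^-1 n = \prod_(1 <= i < n.+1) (1 - 1 / p ^+ i).
  by rewrite -poch_nat mul1r.
(* The last product of [Pdu] is a quotient of Pochhammer products; its denominator comes from the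
   first step, from [d] to [size la]. *)
have -> : \prod_(d - size la + 1 <= i < d.+1) (1 - 1 / p ^+ i) =
    poch p p^-1 d / poch p p^-1 (d - size la).
  rewrite [X in X / _]E [in RHS](@big_cat_nat _ _ _ (d - size la).+1) ?ltnS ?leq_subr//=.
  by rewrite -E [X in X / _]mulrC mulfK ?addn1// gt_eqF// poch_gt0 ?invp_itv.
by rewrite -poch_nat /= c0 !poch0 !mulr1 !invfM; ring.
Qed.

End PathWeight.

(** * Eventually constant sequences and countable unions of null sets *)

Lemma nonincreasing_nat_stable (c : nat -> nat) :
  (forall i, (c i.+1 <= c i)%N) ->
  exists N, forall i, (N <= i)%N -> c i = c N.
Proof.
have [m] := ubnP (c 0%N); elim: m c => // m IH c c0m c_dec.
have c_le i : (c i <= c 0%N)%N by elim: i => // i; exact: leq_trans.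
have [[i ci]|h] := pselect (exists i, (c i < c 0%N)%N); last first.
  exists 0%N => i _; apply/eqP; rewrite eqn_leq c_le leqNgt.
  by apply/negP => ci; apply: h; exists i.
(* After a strict drop at [i], the tail from [i] starts at a smaller value. *)
have [||N HN] := IH (fun j => c (i + j)%N).
- by rewrite addn0 (leq_trans ci).
- by move=> j; rewrite addnS.
exists (i + N)%N => j ij; have ij' := leq_trans (leq_addr N i) ij.
by rewrite -(HN (j - i)%N) ?subnKC// -(leq_add2l i) subnKC.
Qed.

Lemma negligible_bigcup_countType (d : measure_display) (T : measurableType d) (R : realType)
    (mu : {measure set T -> \bar R}) (I : countType) (F : I -> set T) :
  (forall i, mu.-negligible (F i)) -> mu.-negligible (\bigcup_i F i).
Proof.
move=> h; apply: (@negligibleS _ _ _ _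
    (\bigcup_n (if unpickle n is Some i then F i else set0))).
  by move=> t [i _ Fit]; exists (pickle i) => //=; rewrite pickleK.
apply: negligible_bigcup => n; case: unpickle => [i|]; [exact: h|exact: negligible_set0].
Qed.

(** * Probabilities of whole trajectories *)

Section MarkovChain.
Set Implicit Arguments.
Unset Strict Implicit.
Unset Printing Implicit Defensive.

Context {disp : measure_display} {T : measurableType disp} {R : realType}.
Variables (P : probability T R) (X : nat -> {RV P >-> nat}).

Definition trajectory (a : nat -> nat) : set T := [set t | forall i, X i t = a i].

Lemma measurable_RV_eq i n : measurable [set t | X i t = n].
Proof. exact: (measurable_funPTI (X i) (Y := [set n])). Qed.

Lemma cylinderS n a :
  cylinder X n.+1 a = cylinder X n a `&` [set t | X n.+1 t = a n.+1].
Proof.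
apply/seteqP; split => t /=.
  by move=> h; split => [i im|]; apply: h => //; exact: leqW.
by move=> [h1 h2] i; rewrite leq_eqVlt => /orP[/eqP->//|]; exact: h1.
Qed.

Lemma cylinder0 a : cylinder X 0 a = [set t | X 0%N t = a 0%N].
Proof.
apply/seteqP; split => t /=; first exact.
by move=> h i; rewrite leqn0 => /eqP->.
Qed.

Lemma measurable_cylinder n a : measurable (cylinder X n a).
Proof.
elim: n => [|n IH]; first by rewrite cylinder0; exact: measurable_RV_eq.
by rewrite cylinderS; apply: measurableI => //; exact: measurable_RV_eq.
Qed.

Lemma trajectory_bigcap a : trajectory a = \bigcap_n cylinder X n a.
Proof.
apply/seteqP; split => t /= h; first by move=> n _ i _; exact: h.
by move=> i; exact: (h i).
Qed.

Lemma measurable_trajectory a : measurable (trajectory a).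
Proof.
by rewrite trajectory_bigcap; apply: bigcapT_measurable => n; exact: measurable_cylinder.
Qed.

Lemma trajectory_sub_cylinder n a : trajectory a `<=` cylinder X n a.
Proof. by rewrite trajectory_bigcap; exact: bigcap_inf. Qed.

Variables (x0 : nat) (k : nat -> nat -> R).
Hypothesis chainX : markov_chain x0 k X.

Lemma prob_cylinder n a : a 0%N = x0 -> P (cylinder X n a) = (path_weight k a n)%:E.
Proof.
move=> a0; elim: n => [|n IH].
  by rewrite cylinder0 a0 chainX.1 /path_weight big_ord0.
by rewrite chainX.2 IH /path_weight big_ord_recr -EFinM.
Qed.

(** Continuity from above: a trajectory is the decreasing intersection of its cylinders, whose
    probabilities are eventually [w]. *)
Lemma prob_trajectory N a w : a 0%N = x0 ->
  (forall n, (N <= n)%N -> path_weight k a n = w) -> P (trajectory a) = w%:E.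
Proof.
move=> a0 aw; rewrite trajectory_bigcap.
have cv : P (cylinder X n a) @[n --> \oo] --> P (\bigcap_n cylinder X n a).
  apply: nonincreasing_cvg_mu.
  - by rewrite (le_lt_trans (probability_le1 _ _)) ?ltry//; exact: measurable_cylinder.
  - by move=> n; exact: measurable_cylinder.
  - by rewrite -trajectory_bigcap; exact: measurable_trajectory.
  - move=> m n mn; apply/subsetPset => t h i im; apply: h; exact: leq_trans mn.
apply: (cvg_unique _ cv) => //; apply: cvg_near_cst.
by exists N => // n /= Nn; rewrite prob_cylinder// aw.
Qed.

(** From time [N] on, each step multiplies the cylinder probability by [k v v < 1], so it decays
    geometrically. *)
Lemma negligible_trajectory_stable N a v : 0 <= k v v < 1 ->
  (forall i, (N <= i)%N -> a i = v) -> P.-negligible (trajectory a).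
Proof.
move=> /andP[k0 k1] av; have mtraj := measurable_trajectory a.
suff P0 : P (trajectory a) = 0%E by exact/negligibleP.
have le_geo j : (P (cylinder X (N + j) a) <= (k v v ^+ j)%:E)%E.
  elim: j => [|j IH].
    by rewrite expr0 probability_le1//; exact: measurable_cylinder.
  rewrite addnS chainX.2 !av ?leqW ?leq_addr// exprSr EFinM.
  by rewrite lee_wpmul2r ?lee_fin.
have fin : P (trajectory a) \is a fin_num by rewrite fin_num_measure.
rewrite -(fineK fin); congr (_%:E); apply/eqP; rewrite eq_le fine_ge0// andbT.
have cv : (k v v ^+ j) @[j --> \oo] --> (0 : R) by apply: cvg_expr; rewrite ger0_norm.
rewrite -(cvg_lim _ cv)//; apply: limr_ge; first by apply/cvg_ex; exists 0.
near=> j; rewrite -lee_fin fineK//; apply: le_trans (le_geo j).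
by rewrite le_measure ?inE//; [exact: measurable_cylinder|exact: trajectory_sub_cylinder].
Unshelve. all: by end_near. Qed.

Lemma chain_absorbed : (forall a b, (a < b)%N -> k a b = 0) ->
  (forall a, (0 < a)%N -> 0 <= k a a < 1) ->
  {ae P, forall t, (forall i, (X i.+1 t <= X i t)%N) /\
    exists N, forall i, (N <= i)%N -> X i t = 0%N}.
Proof.
move=> k_up k_diag.
(* Finite sequences index both families of exceptional events, which keeps the unions countable. A
   cylinder sees only finitely many values; in [stable], the default of [nth] prolongs [s] by its
   last entry. *)
pose up n (s : seq nat) := if (nth 0 s n < nth 0 s n.+1)%N
  then cylinder X n.+1 (nth 0%N s) else set0.
pose stable (s : seq nat) := if (0 < last 0 s)%N
  then trajectory (nth (last 0%N s) s) else set0.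
apply: (@negligibleS _ _ _ _
    ((\bigcup_n \bigcup_s up n s) `|` \bigcup_s stable s)); last first.
  apply: negligibleU.
    apply: negligible_bigcup_countType => n; apply: negligible_bigcup_countType => s.
    rewrite /up; case: ifPn => [h|_]; last exact: negligible_set0.
    have P0 : P (cylinder X n.+1 (nth 0%N s)) = 0%E by rewrite chainX.2 k_up// mule0.
    by apply/negligibleP => //; exact: measurable_cylinder.
  apply: negligible_bigcup_countType => s.
  rewrite /stable; case: ifPn => [h|_]; last exact: negligible_set0.
  apply: (@negligible_trajectory_stable (size s) _ (last 0%N s)); first exact: k_diag.
  by move=> i si; rewrite nth_default.
move=> t /= bad.
have [[n Xn]|h] := pselect (exists n, (X n t < X n.+1 t)%N).
  left; exists n => //; exists (mkseq (fun i => X i t) n.+2) => //.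
  by rewrite /up !nth_mkseq// Xn => i ni /=; rewrite nth_mkseq.
have dec i : (X i.+1 t <= X i t)%N by rewrite leqNgt; apply/negP => Xi; apply: h; exists i.
right; have [N HN] := @nonincreasing_nat_stable (fun i => X i t) dec.
exists (mkseq (fun i => X i t) N.+1) => //.
have lastE : last 0%N (mkseq (fun i => X i t) N.+1) = X N t.
  by rewrite (last_nth 0%N) size_mkseq /= -/(mkseq _ _) (nth_mkseq 0 _ (ltnSn N)).
rewrite /stable lastE; case: posnP => [XN0|_].
  (* A limit 0 would make [t] a good point. *)
  by case: bad; split=> //; exists N => i /HN ->.
move=> i; have [iN|Ni] := leqP i N; first by rewrite nth_mkseq.
by rewrite nth_default ?size_mkseq// HN// ltnW.
Qed.

End MarkovChain.

Theorem theorem2p2 (R : realType) (p u : R) (d : nat)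
    (hp : 1 < p) (hu0 : 0 < u) (hup : u < p) (hd : (0 < d)%N) :
  (forall a : nat,
     (forall b : nat, 0 <= K p u a b) /\ \sum_(b < a.+1) K p u a b = 1) /\
  (forall (disp : measure_display) (T : measurableType disp)
          (P : probability T R) (X : nat -> {RV P >-> nat}),
     markov_chain d (K p u) X ->
     {ae P, forall t, exists la : intpart, has_columns la (fun i => X i t)} /\
     (forall la : intpart,
        P [set t | has_columns la (fun i => X i t)] = (Pdu p u d la)%:E)).
Proof.
have hu : 0 < u < p by rewrite hu0.
split=> [a|disp T P X chainX].
  by split=> [b|]; [exact: K_ge0|exact: K_sum].
split.
  have : {ae P, forall t, (forall i, (X i.+1 t <= X i t)%N) /\
      exists N, forall i, (N <= i)%N -> X i t = 0%N}.
    apply: (chain_absorbed chainX) => [a b ab|a a0]; first by rewrite /K leqNgt ab.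
    by rewrite K_ge0//= K_diag_lt1.
  apply: filterS => t [dec [N XN]].
  by apply: (@exists_columns _ N) => [i|]; [exact: dec|exact: XN].
move=> la; set E := [set t | _].
pose a := columns_from d la.
(* [has_columns] leaves [X 0] free; fixing it to [d], an event of probability 1, turns [E] into a
   single trajectory. *)
have EE : E `&` [set t | X 0%N t = d] = trajectory X a.
  apply/seteqP; split => t /=.
    by move=> [h X0] [|i]//=; rewrite -(h i.+1).
  by move=> h; split; [move=> [|i]// _; rewrite h|rewrite h].
have mE : measurable E.
  rewrite (_ : E = \bigcap_i [set t | X i.+1 t = Defs.col la i.+1]).
    by apply: bigcapT_measurable => i; exact: measurable_RV_eq.
  apply/seteqP; split => t /= h; first by move=> i _; rewrite /= -(h i.+1).
  by move=> [|i]// _; rewrite (h i).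
have m0 := measurable_RV_eq X 0 d.
have -> : P E = P (E `&` [set t | X 0%N t = d]).
  have Pc : P (~` [set t | X 0%N t = d]) = 0%E.
    by rewrite probability_setC// chainX.1 subee.
  rewrite (measureDI _ mE m0) [X in (X + _)%E](_ : _ = 0%E) ?add0e//.
  apply: subset_measure0 Pc; [exact: measurableD|exact: measurableC|by move=> t []].
rewrite EE; apply: (prob_trajectory chainX (N := (largest la).+1)) => // n Ln.
(* Every step after time [(largest la).+1] goes from 0 to 0 and contributes the factor
   [K p u 0 0 = 1]. *)
rewrite -path_weight_columns// /path_weight -(subnKC Ln) big_split_ord /=.
rewrite [X in _ * X]big1 ?mulr1// => i _.
by rewrite /a /columns_from /= !col_gt_largest ?K00//; lia.
Qed.
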